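(* Let $(G,+)$ be an Abelian topological group and let $x\mapsto x^*$ be a continuous map $G\to G$. Let $\Omega$ be a nonempty open subset of $G$, let $S=\Omega+\Omega^*=\{x+y^*:x,y\in\Omega\}$, and let $f:S\to\mathbb{C}$ be a positive definite function. Then $f$ is continuous in $S$ if and only if $\Re(f)$ is continuous in $D_\Omega(S)=\{x+x^*:x\in\Omega\}$.
   Context: $f:S\to\mathbb{C}$ is positive definite (with respect to $\Omega$ and the map $x\mapsto x^*$) if $k(x,y)=f(x+y^* )$ is a positive definite kernel on $\Omega$, that is, $\sum_{i,j=1}^n f(x_i+x_j^* )\,\xi_i\,\overline{\xi_j}\ge 0$ for every $n\in\mathbb{N}$ and all finite collections $\{x_j\}_{j=1}^n\subset\Omega$ and $\{\xi_j\}_{j=1}^n\subset\mathbb{C}$. The map $x\mapsto x^*$ is an arbitrary continuous map (not assumed to be an involution). $S$ carries the subspace topology from $G$. ''$\Re(f)$ is continuous in $D_\Omega(S)$'' means that $\Re(f)$, as a function on $S$, is continuous at every point of $D_\Omega(S)$. *)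

(* Defs.v *)
From HB Require Import structures.
From mathcomp Require Import all_boot all_order all_algebra complex.
From mathcomp Require Import all_classical all_reals all_analysis.

Set Implicit Arguments.
Unset Strict Implicit.
Unset Printing Implicit Defensive.

Import Order.TTheory GRing.Theory Num.Theory.

Local Open Scope classical_set_scope.
Local Open Scope ring_scope.
Local Open Scope complex_scope.

(* In the partial order of R[i], 0 <= z means that z is real and nonnegative. *)
Definition positive_definite_kernel (R : realType) (T : Type) (Omega : set T)
    (k : T -> T -> R[i]) : Prop :=
  forall (n : nat) (x : 'I_n -> T) (xi : 'I_n -> R[i]),
    (forall i, Omega (x i)) ->
    0 <= \sum_(i < n) \sum_(j < n) k (x i) (x j) * xi i * (xi j)^*.

Definition sum_domain (G : zmodType) (star : G -> G) (Omega : set G) : set G :=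
  [set x + star y | x in Omega & y in Omega].

Definition diagonal_sums (G : zmodType) (star : G -> G) (Omega : set G) :
    set G :=
  [set x + star x | x in Omega].

(* A function on S = sum_domain star Omega is represented by a total function
   f on G; only its values on S occur here. *)
Definition positive_definite (R : realType) (G : zmodType) (star : G -> G)
    (Omega : set G) (f : G -> R[i]) : Prop :=
  positive_definite_kernel Omega (fun x y => f (x + star y)).

(* Main.v *)
Require Import Defs.
From HB Require Import structures.
From mathcomp Require Import all_boot all_order all_algebra complex.
From mathcomp Require Import all_classical all_reals all_analysis.
From mathcomp Require Import ring lra.

Set Implicit Arguments.
Unset Strict Implicit.
Unset Printing Implicit Defensive.

Import Order.TTheory GRing.Theory Num.Theory.
Import numFieldNormedType.Exports.

Local Open Scope classical_set_scope.
Local Open Scope ring_scope.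
Local Open Scope complex_scope.

(** Write k x y = f (x + star y). Only the implication from the diagonal to S
    has content. Positive definiteness of k gives the inequality
      |k x y - k x' y|^2 <= k y y (k x x + k x' x' - 2 Re (k x x'))
    (pd_kernel_sqr_normc_diff), whose right-hand side involves values of Re f
    only, the diagonal values of k being real. Fix a point s = a + star b of S.
    By openness of Omega, each t close to s is x + star b
    with x = a + (t - s) in Omega, and the inequality for x, a, b reads
      |f t - f s|^2 <= f (b + star b)
        (Re f (x + star x) + Re f (a + star a) - 2 Re f (x + star a)).
    As t tends to s, both x + star x and x + star a tend to a + star a inside S,
    so continuity of Re f at this one diagonal point makes the bound tend to 0
    (positive_definite_continuous_at). The continuity obtained is that of f on a
    full neighbourhood of s in G, as S is open. *)

Section PositiveDefiniteKernel.

Variables (R : realType) (T : Type) (Omega : set T) (k : T -> T -> R[i]).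
Hypothesis k_pd : positive_definite_kernel Omega k.

(** The quadratic form of a pair of points is real; the coefficient vectors
    (1, 0), (0, 1), (1, 1) and (1, i) already force the two off-diagonal values
    to be conjugate. *)
Lemma pd_kernel_hermitian (x y : T) :
  Omega x -> Omega y -> k y x = (k x y)^*.
Proof.
move=> Ox Oy.
pose p (i : 'I_2) := if i == ord0 then x else y.
have Op i : Omega (p i) by rewrite /p; case: ifP.
pose c (z w : R[i]) (i : 'I_2) := if i == ord0 then z else w.
have h z w := @k_pd 2 p (c z w) Op.
have := (h 1 0, h 0 1, h 1 1, h 1 'i%C).
rewrite !(big_ord_recl, big_ord0) /c /p /= !lecE.
case: (k x x) (k x y) (k y x) (k y y) => [a a'] [b b'] [d d'] [e e'] /=.
move=> [[[/andP[/eqP h1 _] /andP[/eqP h2 _]] /andP[/eqP h3 _]]].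
move=> /andP[/eqP h4 _].
congr Complex; lra.
Qed.

(** In the Hilbert space where k is the Gram kernel of vectors v_x, this is the
    Cauchy-Schwarz inequality for v_x - v_x' and v_y. It is proved directly from
    the quadratic form at x, x', y with coefficients 1, -1, -s w, where w is the
    difference to be bounded: this is a nonnegative quadratic polynomial in the
    real number s. The bound contains only real parts of values of k, which is
    why the theorem needs no more than the real part of f. *)
Lemma pd_kernel_sqr_normc_diff (x x' y : T) :
  Omega x -> Omega x' -> Omega y ->
  Normc.normc (k x y - k x' y) ^+ 2 <=
    complex.Re (k y y) *
    (complex.Re (k x x) + complex.Re (k x' x') - 2 * complex.Re (k x x')).
Proof.
move=> Ox Ox' Oy.
pose p (i : 'I_3) := if i == ord0 then x else if i == ord_max then y else x'.
have Op i : Omega (p i) by rewrite /p; case: ifP => // _; case: ifP.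
set w := k x y - k x' y.
pose c (s : R) (i : 'I_3) :=
  if i == ord0 then 1 else if i == ord_max then - (s%:C * w) else -1.
have key s : 0 <= complex.Re (k x x) + complex.Re (k x' x')
    - 2 * complex.Re (k x x') - 2 * s * Normc.normc w ^+ 2
    + s ^+ 2 * complex.Re (k y y) * Normc.normc w ^+ 2.
  have := @k_pd 3 p (c s) Op.
  rewrite !(big_ord_recl, big_ord0) /c /p /= lecE => /andP[_].
  rewrite (pd_kernel_hermitian Ox Ox') (pd_kernel_hermitian Ox Oy).
  rewrite (pd_kernel_hermitian Ox' Oy) /w /Normc.normc.
  case: (k x x) (k x y) (k x' y) (k y y) (k x x') (k x' x')
    => [a a'] [b b'] [d d'] [e e'] [g g'] [m m'] /=.
  rewrite sqr_sqrtr; last by rewrite addr_ge0 ?sqr_ge0.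
  move=> h.
  apply: le_trans h _; rewrite le_eqVlt; apply/orP; left; apply/eqP; ring.
have B0 : 0 <= complex.Re (k y y).
  have := @k_pd 1 (fun=> y) (fun=> 1%:C) (fun=> Oy).
  by rewrite !big_ord1 lecE /= => /andP[_]; case: (k y y) => e e' /=; lra.
move: (complex.Re (k y y)) (_ ^+ 2) (sqr_ge0 (Normc.normc w)) key B0.
move=> B N N0 key.
set A := complex.Re _ + _ - _ in key *.
rewrite le_eqVlt => /orP[/eqP B0|B0].
  (* Here the quadratic is affine in s; for N > 0 it takes the value -1. *)
  rewrite -B0 mul0r leNgt; apply/negP => N_gt0.
  have := key ((A + 1) / (2 * N)); rewrite -B0 mulr0 mul0r addr0.
  have -> : A - 2 * ((A + 1) / (2 * N)) * N = -1 by field; lra.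
  by rewrite lerNr oppr0 ler10.
have := key B^-1.
have -> : A - 2 * B^-1 * N + B^-1 ^+ 2 * B * N = (B * A - N) / B.
  by field; rewrite gt_eqF.
by rewrite pmulr_lge0 ?invr_gt0// subr_ge0.
Qed.

End PositiveDefiniteKernel.

Lemma continuous_complex_Re (R : realType) :
  continuous (fun z : R[i]^o => complex.Re z).
Proof.
move=> z.
have FF := nbhs_filter (z : R[i]^o); apply/cvgrPdist_lt => e e0.
have e0' : 0 < e%:C :> R[i] by rewrite ltcR.
apply: filterS (nbhsx_ballx (z : R[i]^o) _ e0') => t /=.
move=> /(le_lt_trans (normc_ge_Re _)).
by rewrite ltcR raddfB.
Qed.

(** A squeeze lemma needed because the topology of R[i]^o is given by balls
    whose radii are positive elements of R[i], while the bound h is real. *)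
Lemma cvg_normc_sqr_le (R : realType) (X : Type) (F : set_system X)
    (FF : Filter F) (g : X -> R[i]^o) (z : R[i]) (h : X -> R) :
  (\forall t \near F, Normc.normc (g t - z) ^+ 2 <= h t) ->
  h @ F --> (0 : R) -> g @ F --> (z : R[i]^o).
Proof.
move=> gh h0; apply/cvgrPdist_lt => -[e e'].
rewrite ltcE/= => /andP[/eqP -> e0].
have /cvgrPdist_lt /(_ _ (exprn_gt0 2 e0)) := h0.
apply: filter_app; apply: filterS gh => t gh ht.
rewrite distrC.
change ((Normc.normc (g t - z))%:C < e%:C); rewrite ltcR.
rewrite -(@ltr_pXn2r _ 2)// ?nnegrE ?sqrtr_ge0 ?(ltW e0)//; last first.
  by case: (g t - z) => *; rewrite sqrtr_ge0.
apply: le_lt_trans gh _; apply: le_lt_trans ht.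
by rewrite sub0r normrN ler_norm.
Qed.


Section Continuity.

Variables (R : realType) (G : topologicalZmodType).
Variables (star : G -> G) (Omega : set G).
Hypotheses (star_cont : continuous star) (Omega_open : open Omega).

Let S := sum_domain star Omega.

(** Openness of Omega keeps the sums u + star v inside S near the limit, so a
    limit taken within S can be followed along them. *)
Lemma cvg_sum_domain (X : Type) (F : set_system X) (FF : Filter F)
    (U : topologicalType) (g : G -> U) (l : U) (u v : X -> G) (a b : G) :
  Omega a -> Omega b ->
  g @ within S (nbhs (a + star b)) --> l ->
  u @ F --> a -> v @ F --> b ->
  g (u t + star (v t)) @[t --> F] --> l.
Proof.
move=> Oa Ob gl ua vb.
apply: cvg_trans gl => A /= SA.
have sum_cvg : u t + star (v t) @[t --> F] --> a + star b.
  have svb := cvg_comp _ _ vb (@star_cont b).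
  exact: (continuous2_cvg FF (@add_continuous G (a, star b)) ua svb).
have Ou : \forall t \near F, Omega (u t).
  exact: (ua _ (open_nbhs_nbhs (conj Omega_open Oa))).
have Ov : \forall t \near F, Omega (v t).
  exact: (vb _ (open_nbhs_nbhs (conj Omega_open Ob))).
have uvA : \forall t \near F,
  S (u t + star (v t)) -> A (g (u t + star (v t))) by exact: (sum_cvg _ SA).
change (\forall t \near F, A (g (u t + star (v t)))).
near=> t; apply: (near uvA t) => //.
exists (u t); first by near: t.
by exists (v t) => //; near: t.
Unshelve. all: by end_near.
Qed.

Variable f : G -> R[i]^o.
Hypothesis f_pd : positive_definite star Omega f.
Hypothesis Re_cont : forall a, Omega a ->
  complex.Re (f t) @[t --> within S (nbhs (a + star a))]
    --> complex.Re (f (a + star a)).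

(** A point t near s = a + star b need not be presented with summands near a and
    b, but it can be rewritten as u t + star b with u t = a + (t - s), which lies
    in Omega because Omega is open. Only the first argument of the kernel moves,
    so the kernel inequality applies with y = b, and its right-hand side involves f
    at sums tending to the single point a + star a. *)
Lemma positive_definite_continuous_at (s : G) : S s -> {for s, continuous f}.
Proof.
move=> [a Oa [b Ob <-{s}]]; set s := a + star b.
pose u t := a + (t - s).
have u_cvg : u t @[t --> s] --> a.
  have : t - s @[t --> s] --> s - s.
    exact: (@continuous2_cvg _ _ _ _ _ _ _ _ (fun x y : G => x - y) _ _
      (@sub_continuous G (s, s)) cvg_id (cvg_cst s)).
  rewrite subrr => ts.
  rewrite -[X in _ --> X]addr0.
  exact: (@continuous2_cvg _ _ _ _ _ _ _ _ (fun x y : G => x + y) _ _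
    (@add_continuous G (a, 0)) (cvg_cst a) ts).
have uE t : u t + star b = t by rewrite /u addrAC addrC subrK.
have Ou : \forall t \near s, Omega (u t).
  exact: (u_cvg _ (open_nbhs_nbhs (conj Omega_open Oa))).
pose h t := complex.Re (f (b + star b)) *
  (complex.Re (f (u t + star (u t))) + complex.Re (f (a + star a))
   - 2 * complex.Re (f (u t + star a))).
apply: (@cvg_normc_sqr_le _ _ _ _ _ _ h).
  apply: filterS Ou => t Out.
  by have := pd_kernel_sqr_normc_diff f_pd Out Oa Ob; rewrite /= uE.
have Re1 : complex.Re (f (u t + star (u t))) @[t --> s]
    --> complex.Re (f (a + star a)).
  exact: (cvg_sum_domain _ Oa Oa (Re_cont Oa) u_cvg u_cvg).
have Re2 : complex.Re (f (u t + star a)) @[t --> s]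
    --> complex.Re (f (a + star a)).
  exact: (cvg_sum_domain _ Oa Oa (Re_cont Oa) u_cvg (cvg_cst a)).
rewrite /h -[X in _ --> X](mulr0 (complex.Re (f (b + star b)))).
apply: cvgMr.
have -> : 0 = complex.Re (f (a + star a)) + complex.Re (f (a + star a))
  - 2 * complex.Re (f (a + star a)) by ring.
apply: cvgB; first by apply: cvgD Re1 _; exact: cvg_cst.
exact: cvgMr Re2.
Qed.

End Continuity.

(* R[i]^o is the library's alias of R[i] carrying the topology of the modulus.
   subspace S has the topology of S around the points of S; continuity of f as
   a function on S, at all points resp. at a point of S, is continuity on it. *)
Theorem corollary2p5 (R : realType) (G : topologicalZmodType)
    (star : G -> G) (Omega : set G) (f : G -> R[i]^o)
    (star_cont : continuous star)
    (Omega_nonempty : Omega !=set0) (Omega_open : open Omega)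
    (f_pd : positive_definite star Omega f) :
  {within sum_domain star Omega, continuous f} <->
  (forall x : G, diagonal_sums star Omega x ->
     {for x, continuous
       ((fun y => complex.Re (f y)) : subspace (sum_domain star Omega) -> R)}).
Proof.
split=> [/subspace_continuousP f_cont _ [a Oa <-]|Re_cont].
  have Sa : sum_domain star Omega (a + star a) by exists a => //; exists a.
  suff : complex.Re (f t) @[t --> within (sum_domain star Omega)
      (nbhs (a + star a))] --> complex.Re (f (a + star a)).
    by rewrite (nbhs_subspace_in Sa).
  exact: (cvg_comp _ _ (f_cont _ Sa) (@continuous_complex_Re R _)).
apply/subspace_continuousP => s Ss; apply: cvg_within_filter.
apply: (positive_definite_continuous_at star_cont Omega_open f_pd) Ss => a Oa.
have Sa : sum_domain star Omega (a + star a) by exists a => //; exists a.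
rewrite (nbhs_subspace_in Sa); apply: Re_cont.
by exists a.
Qed.
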